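(* Let $\mathcal{H}$ be a finite-dimensional real Hilbert space, $\mathcal{H}\neq\{0\}$, and let $\alpha,\beta\in\,]0,\infty[$, $\rho,\mu\in[0,\infty[$ with $\rho\le\alpha^{-1}$ and $\mu\le\beta^{-1}$; consider $f\in\mathcal{F}_{\rho,\alpha^{-1}}$ and $g\in\mathcal{F}_{\mu,\beta^{-1}}$. The exact worst-case contraction factors of GM, FBS1, FBS2, PRS and DRS satisfy respectively, for every admissible step size $\tau$ of the method, $$r_{\mathrm{GM}}(\tau)\ge\max\{|1-\tau(\rho+\mu)|,\,|1-\tau(\beta^{-1}+\alpha^{-1})|\},$$ $$r_{\mathrm{FBS1}}(\tau)\ge\frac{1}{1+\tau\mu}\max\{|1-\tau\rho|,\,|1-\tau\alpha^{-1}|\},$$ $$r_{\mathrm{FBS2}}(\tau)\ge\frac{1}{1+\tau\rho}\max\{|1-\tau\mu|,\,|1-\tau\beta^{-1}|\},$$ $$r_{\mathrm{PRS}}(\tau)\ge\max_{\substack{a\in\{\rho,\alpha^{-1}\}\\ b\in\{\mu,\beta^{-1}\}}}\frac{|1-\tau a|}{1+\tau a}\,\frac{|1-\tau b|}{1+\tau b},$$ $$r_{\mathrm{DRS}}(\tau)\ge\max\left\{\max_{\substack{a\in\{\rho,\alpha^{-1}\}\\ b\in\{\mu,\beta^{-1}\}}}\frac{1+\tau^2ab}{(1+\tau a)(1+\tau b)},\ T_\mu(\tau)\right\},$$ for some function $T_\mu:\,]0,\infty[\,\to[0,\infty[$ (not explicitly identified).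
   Context: For $0\le m\le L$, $\mathcal{F}_{m,L}$ denotes the class of functions $\mathcal{H}\to\mathbb{R}$ that are $L$-smooth (differentiable with $L$-Lipschitz gradient) and $m$-strongly convex ($0$-strongly convex means convex). For $\tau>0$ and convex $\varphi$, $\mathrm{prox}_{\tau\varphi}(x)=\arg\min_{z\in\mathcal{H}}\ \tau\varphi(z)+\tfrac12\|z-x\|^2$. The methods, for solving $\min_{x\in\mathcal{H}} f(x)+g(x)$, are given by one-iteration maps $\Phi_{f,g}:\mathcal{H}\to\mathcal{H}$ depending on a step size $\tau$, with the following admissible ranges: - Gradient method (GM), $\tau\in\,]0,\frac{2}{\alpha^{-1}+\beta^{-1}}[$: $\Phi_{f,g}x=x-\tau(\nabla f(x)+\nabla g(x))$. - Forward-backward splitting (FBS1), $\tau\in\,]0,2\alpha[$: $\Phi_{f,g}x=\mathrm{prox}_{\tau g}(x-\tau\nabla f(x))$. - Forward-backward splitting (FBS2), $\tau\in\,]0,2\beta]$: $\Phi_{f,g}x=\mathrm{prox}_{\tau f}(x-\tau\nabla g(x))$. - Peaceman-Rachford splitting (PRS), $\tau>0$: $y=\mathrm{prox}_{\tau f}(x)$, $\Phi_{f,g}x=2\,\mathrm{prox}_{\tau g}(2y-x)-2y+x$. - Douglas-Rachford splitting (DRS), $\tau>0$: $y=\mathrm{prox}_{\tau f}(x)$, $\Phi_{f,g}x=\mathrm{prox}_{\tau g}(2y-x)-y+x$. The exact worst-case contraction factor $r_{\mathcal{A}}(\tau)$ of a method $\mathcal{A}$ is the smallest $r\ge 0$ such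 that $\|\Phi_{f,g}x-\Phi_{f,g}y\|\le r\|x-y\|$ for all $f\in\mathcal{F}_{\rho,\alpha^{-1}}$, all $g\in\mathcal{F}_{\mu,\beta^{-1}}$ and all $x,y\in\mathcal{H}$. *)

(* Defs.v *)
From HB Require Import structures.
From mathcomp Require Import all_boot all_order all_algebra.
From mathcomp Require Import all_classical all_reals all_analysis.
Set Implicit Arguments.
Unset Strict Implicit.
Unset Printing Implicit Defensive.
Import Order.TTheory GRing.Theory Num.Theory.
Import numFieldNormedType.Exports.
Local Open Scope classical_set_scope.
Local Open Scope ring_scope.

Definition finite_dimensional (R : realType) (H : lmodType R) : Prop :=
  exists (n : nat) (e : 'I_n -> H),
    forall x : H, exists c : 'I_n -> R, x = \sum_(i < n) c i *: e i.

(* The norm of H is the one of the inner product; completeness of H follows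
   from finite dimension. *)
Definition finite_dimensional_hilbert (R : realType) (H : normedModType R)
    (dot : {dot H for idfun}) : Prop :=
  (forall x : H, dot x x = `|x| ^+ 2) /\ finite_dimensional H.

Section Methods.
Context (R : realType) (H : normedModType R) (dot : {dot H for idfun}).
Implicit Types (f g phi : H -> R) (x y z : H) (m L tau : R).

(* Riesz representative of the Frechet derivative. It is unique, and exists when
   H is finite-dimensional, so the default value 0 plays no role where f is
   differentiable. *)
Definition grad f x : H := xget 0 [set v : H | forall h, 'd f x h = dot v h].

Definition smooth L f : Prop :=
  (forall x, differentiable f x) /\
  (forall x y, `|grad f x - grad f y| <= L * `|x - y|).

Definition strongly_convex m f : Prop :=
  convex_function setT (fun x => f x - m / 2 * `|x| ^+ 2).

Definition smooth_strongly_convex m L : set (H -> R) :=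
  [set f | smooth L f /\ strongly_convex m f].

(* For continuous convex phi, tau > 0 and H finite-dimensional, the minimizer
   exists and is unique, so the default value 0 plays no role. *)
Definition prox tau phi x : H :=
  xget 0 [set p : H | forall z,
    tau * phi p + 2^-1 * `|p - x| ^+ 2 <= tau * phi z + 2^-1 * `|z - x| ^+ 2].

Definition GM tau f g x : H := x - tau *: (grad f x + grad g x).

Definition FBS1 tau f g x : H := prox tau g (x - tau *: grad f x).

Definition FBS2 tau f g x : H := prox tau f (x - tau *: grad g x).

Definition PRS tau f g x : H :=
  let y := prox tau f x in 2 *: prox tau g (2 *: y - x) - 2 *: y + x.

Definition DRS tau f g x : H :=
  let y := prox tau f x in prox tau g (2 *: y - x) - y + x.

Section Factor.
Variables (rho mu alpha beta : R) (Phi : (H -> R) -> (H -> R) -> H -> H).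

Definition contraction_constants : set R :=
  [set r | 0 <= r /\ forall f g,
     smooth_strongly_convex rho alpha^-1 f ->
     smooth_strongly_convex mu beta^-1 g ->
     forall x y, `|Phi f g x - Phi f g y| <= r * `|x - y|].

(* The smallest contraction constant, see contraction_factor_smallest; +oo if
   there is no contraction constant. *)
Definition contraction_factor : \bar R :=
  ereal_inf [set r%:E | r in contraction_constants].

Lemma contraction_factor_smallest : contraction_constants !=set0 ->
  exists r, [/\ contraction_factor = r%:E, contraction_constants r &
    forall s, contraction_constants s -> r <= s].
Proof.
move=> ne.
have lb : has_lbound contraction_constants by exists 0 => s [].
have hinf : has_inf contraction_constants by split.
have ler s : contraction_constants s -> inf contraction_constants <= s.
  by move=> cs; apply: ge_inf.
exists (inf contraction_constants); split=> //.
- by rewrite /contraction_factor ereal_inf_EFin.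
- split=> [|f g hf hg x y]; first by apply: lb_le_inf => // s [].
  have [->|xy] := eqVneq x y; first by rewrite !subrr !normr0 mulr0.
  have nxy : 0 < `|x - y| by rewrite normr_gt0 subr_eq0.
  rewrite -ler_pdivrMr//; apply: lb_le_inf => // s [s0 hs].
  by rewrite ler_pdivrMr//; exact: hs.
Qed.

End Factor.
End Methods.

(* Maximum of h a b over a in {a1, a2} and b in {b1, b2}. *)
Definition max_pairs (R : realType) (h : R -> R -> R) (a1 a2 b1 b2 : R) : R :=
  Num.max (Num.max (h a1 b1) (h a1 b2)) (Num.max (h a2 b1) (h a2 b2)).

(* Main.v *)
From HB Require Import structures.
Require Import Defs.
From mathcomp Require Import all_boot all_order all_algebra.
From mathcomp Require Import all_classical all_reals all_analysis.
From mathcomp Require Import ring lra.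
Import Order.TTheory GRing.Theory Num.Theory.
Import numFieldNormedType.Exports.
Local Open Scope classical_set_scope.
Local Open Scope ring_scope.

(** The witnesses of the lower bounds are isotropic quadratics: with
    f = a/2 |x|^2 and g = b/2 |x|^2, where a is a modulus between rho and
    1/alpha and b one between mu and 1/beta, the pair (f, g) is admissible.
    The gradient of f is then multiplication by a (grad_quadratic) and its
    proximal map multiplication by 1 / (1 + tau a) (prox_quadratic), so every
    method is multiplication by some scalar k on H. Since H contains two distinct
    points, every contraction constant is at least |k|
    (contraction_factor_ge_scaling). Each entry of the maxima is |k| for one
    choice of a and b among the extreme moduli:
    - GM has k = 1 - tau (a + b);
    - FBS1 has k = (1 - tau a) / (1 + tau b), and b = mu is the choice giving
      the claimed entries; FBS2 is the same with f and g exchanged;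
    - PRS has k = (1 - tau a) / (1 + tau a) * ((1 - tau b) / (1 + tau b)), the
      product of the reflected proximal maps;
    - DRS averages PRS with the identity, k = (1 + k_PRS) / 2, that is
      (1 + tau^2 a b) / ((1 + tau a) (1 + tau b)).
    As a contraction factor is nonnegative, T_mu = 0 is an admissible lower
    bound for DRS. *)

Definition quadratic {R : realType} {H : normedModType R} (a : R) (x : H) : R :=
  a / 2 * `|x| ^+ 2.

Section InnerProductNorm.
Context {R : realType} {H : normedModType R} (dot : {dot H for idfun}).
Hypothesis dotxx : forall x : H, dot x x = `|x| ^+ 2.

Lemma sqr_normD (x y : H) :
  `|x + y| ^+ 2 = `|x| ^+ 2 + `|y| ^+ 2 + 2 * dot x y.
Proof.
rewrite -!dotxx.
have C : dot y x = dot x y by rewrite (hermC dot y x) expr0 mul1r.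
by rewrite linearDl !linearDr /= C; ring.
Qed.

Lemma sqr_normZ (s : R) (x : H) : `|s *: x| ^+ 2 = s ^+ 2 * `|x| ^+ 2.
Proof. by rewrite normrZ exprMn real_normK// num_real. Qed.

Lemma dotZl (s : R) (x y : H) : dot (s *: x) y = s * dot x y.
Proof. by rewrite linearZl_LR. Qed.

Lemma dotZr (s : R) (x y : H) : dot x (s *: y) = s * dot x y.
Proof. by rewrite linearZr_LR. Qed.

(** Polarization turns the triangle inequality for x + y and x - y into the two
    halves of the Cauchy-Schwarz inequality. *)
Lemma norm_dot_le (x y : H) : `|dot x y| <= `|x| * `|y|.
Proof.
have P := sqr_normD x y.
have M : `|x - y| ^+ 2 = `|x| ^+ 2 + `|y| ^+ 2 - 2 * dot x y.
  by rewrite sqr_normD normrN linearNr; ring.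
have Pt := ler_normD x y; have Mt := ler_normB x y.
have := normr_ge0 (x + y); have := normr_ge0 (x - y).
have := normr_ge0 x; have := normr_ge0 y.
by rewrite ler_norml => *; apply/andP; split; nra.
Qed.

Lemma dot_inj (v w : H) : (forall h, dot v h = dot w h) -> v = w.
Proof.
move=> e; apply/eqP; rewrite -subr_eq0 -normr_eq0 -sqrf_eq0 -dotxx.
by rewrite linearBl /= e subrr.
Qed.

(** The first-order expansion of a/2 |x + h|^2 has the remainder a/2 |h|^2. *)
Lemma quadratic_diff (a : R) (x : H) :
  differentiable (quadratic a : H -> R) x /\
  forall h, 'd (quadratic a : H -> R) x h = dot (a *: x) h.
Proof.
pose F h : R := dot (a *: x) h.
have lin : linear_for *%R F by move=> s u v; rewrite /F linearDr /= dotZr.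
pose FM := GRing.isLinear.Build _ _ _ _ _ lin.
pose d : {linear H -> R} := HB.pack F FM.
have dc : continuous d.
  apply/linear_bounded_continuous/linear_boundedP; near=> r => h /=.
  by rewrite (le_trans (norm_dot_le _ _))// ler_wpM2r.
have dE : (quadratic a : H -> R) \o shift x = cst (quadratic a x) + d +o_ 0 id.
  apply/eqaddoP => _ /posnumP[e]; near=> h.
  rewrite !fctE /= /quadratic sqr_normD.
  have -> : dot h x = dot x h by rewrite (hermC dot h x) expr0 mul1r.
  rewrite /F dotZl.
  rewrite [X in `|X|](_ : _ = a / 2 * `|h| * `|h|); last by field.
  rewrite normrM normr_id ler_wpM2r// normrM normr_id.
  (* the summand 1 keeps the radius e / (|a / 2| + 1) defined when a = 0 *)
  apply: (@le_trans _ _ ((`|a / 2| + 1) * `|h|)).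
    by rewrite ler_wpM2r// lerDl.
  rewrite -ler_pdivlMl; last exact: ltr_wpDl.
  near: h; apply: nbhs0_le.
  by rewrite mulr_gt0// invr_gt0 ltr_wpDl.
have du := diff_unique dc dE.
split; last by move=> h; rewrite du.
by apply/diff_locallyP; rewrite du.
Unshelve. all: by end_near. Qed.

Lemma grad_quadratic (a : R) (x : H) : grad dot (quadratic a) x = a *: x.
Proof.
have [_ dq] := quadratic_diff a x.
by apply: xget_unique => // v dv; apply: dot_inj => h; rewrite -dv dq.
Qed.

Lemma quadratic_smooth (a L : R) : `|a| <= L ->
  smooth dot L (quadratic a).
Proof.
move=> aL; split=> [x|x y]; first by have [] := quadratic_diff a x.
by rewrite !grad_quadratic -scalerBr normrZ ler_wpM2r.
Qed.

(** Convexity of c |x|^2 is the identity saying that the convexity defect at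
    t x + (1 - t) y is c t (1 - t) |x - y|^2. *)
Lemma quadratic_strongly_convex (m a : R) : m <= a ->
  strongly_convex m (quadratic a : H -> R).
Proof.
move=> ma t x y _ _; rewrite convRE /quadratic.
have -> : conv t x y = t%:num *: (x : H) + (1 - t%:num) *: (y : H) by [].
rewrite /unstable.onem sqr_normD !sqr_normZ dotZl dotZr.
have t0 : 0 <= t%:num by [].
have t1 : t%:num <= 1 by [].
move: (t%:num) t0 t1 => {}t t0 t1.
have D : 0 <= (a - m) / 2 * (t * (1 - t)) * `|(x : H) - y| ^+ 2.
  by rewrite !mulr_ge0// subr_ge0.
move: D; rewrite sqr_normD normrN linearNr => D.
rewrite -subr_ge0; apply: le_trans D _.
by rewrite le_eqVlt; apply/orP; left; apply/eqP; field.
Qed.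

Lemma quadratic_in_class (m L a : R) : 0 <= a -> m <= a -> a <= L ->
  smooth_strongly_convex dot m L (quadratic a).
Proof.
move=> a0 ma aL; split; last exact: quadratic_strongly_convex.
by apply: quadratic_smooth; rewrite ger0_norm.
Qed.

(** Completing the square: the proximal objective at z exceeds its value at
    p = x / (1 + tau a) by (1 + tau a) / 2 |z - p|^2. *)
Lemma prox_quadratic (tau a : R) (x : H) : 0 < 1 + tau * a ->
  prox tau (quadratic a) x = (1 + tau * a)^-1 *: x.
Proof.
move=> k0; set k := 1 + tau * a in k0 *.
have : x = k *: (k^-1 *: x) by rewrite scalerA divff ?scale1r// gt_eqF.
move: (k^-1 *: x) => p xE.
pose F (z : H) := tau * quadratic a z + 2^-1 * `|z - x| ^+ 2.
have FE z : F z = F p + k / 2 * `|z - p| ^+ 2.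
  rewrite /F /quadratic xE !(sqr_normD _ (- _)) !normrN !linearNr !sqr_normZ /=.
  by rewrite !dotZr dotxx /k; field.
apply: xget_unique => [z|q qmin].
  by change (F p <= F z); rewrite (FE z) lerDl !mulr_ge0// ltW.
have : F q <= F p := qmin p; rewrite (FE q) gerDl => q0.
apply/eqP; rewrite -subr_eq0 -normr_eq0 -sqrf_eq0 eq_le sqr_ge0 andbT.
by rewrite -(pmulr_rle0 _ (_ : 0 < k / 2))// divr_gt0.
Qed.

Section LowerBounds.
Hypothesis H_neq0 : exists x : H, x != 0.
Context {rho mu alpha beta : R}.

Lemma contraction_factor_ge (Phi : (H -> R) -> (H -> R) -> H -> H) (k : R) :
  (forall r, contraction_constants dot rho mu alpha beta Phi r -> k <= r) ->
  (k%:E <= contraction_factor dot rho mu alpha beta Phi)%E.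
Proof.
by move=> kr; apply: le_ereal_inf_tmp => _ [r /kr kr' <-]; rewrite lee_fin.
Qed.

Lemma contraction_factor_ge_scaling (Phi : (H -> R) -> (H -> R) -> H -> H)
    (a b k : R) :
  0 <= a -> rho <= a -> a <= alpha^-1 -> 0 <= b -> mu <= b -> b <= beta^-1 ->
  (forall x, Phi (quadratic a) (quadratic b) x = k *: x) ->
  (`|k|%:E <= contraction_factor dot rho mu alpha beta Phi)%E.
Proof.
move=> a0 la ua b0 lb ub PhiE; apply: contraction_factor_ge => r [_ hr].
have [x x0] := H_neq0.
have := hr _ _ (quadratic_in_class _ _ _ a0 la ua)
  (quadratic_in_class _ _ _ b0 lb ub) x 0.
by rewrite !PhiE scaler0 !subr0 normrZ ler_pM2r// normr_gt0.
Qed.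

End LowerBounds.
End InnerProductNorm.

Theorem proposition3 (R : realType) (H : normedModType R)
    (dot : {dot H for idfun}) (H_hilbert : finite_dimensional_hilbert dot)
    (H_neq0 : exists x : H, x != 0) (mu : R) (mu_ge0 : 0 <= mu) :
  exists T_mu : R -> R,
    (forall tau : R, 0 < tau -> 0 <= T_mu tau) /\
    forall alpha beta rho : R,
      0 < alpha -> 0 < beta -> 0 <= rho ->
      rho <= alpha^-1 -> mu <= beta^-1 ->
    [/\ (forall tau : R, 0 < tau -> tau < 2 / (alpha^-1 + beta^-1) ->
          ((Num.max `|1 - tau * (rho + mu)|
                    `|1 - tau * (beta^-1 + alpha^-1)|)%:E
           <= contraction_factor dot rho mu alpha beta (GM dot tau))%E),
        (forall tau : R, 0 < tau -> tau < 2 * alpha ->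
          (((1 + tau * mu)^-1 *
            Num.max `|1 - tau * rho| `|1 - tau * alpha^-1|)%:E
           <= contraction_factor dot rho mu alpha beta (FBS1 dot tau))%E),
        (forall tau : R, 0 < tau -> tau <= 2 * beta ->
          (((1 + tau * rho)^-1 *
            Num.max `|1 - tau * mu| `|1 - tau * beta^-1|)%:E
           <= contraction_factor dot rho mu alpha beta (FBS2 dot tau))%E),
        (forall tau : R, 0 < tau ->
          ((max_pairs
              (fun a b => `|1 - tau * a| / (1 + tau * a) *
                          (`|1 - tau * b| / (1 + tau * b)))
              rho alpha^-1 mu beta^-1)%:E
           <= contraction_factor dot rho mu alpha beta (PRS tau))%E) &
        (forall tau : R, 0 < tau ->
          ((Num.max
              (max_pairs
                 (fun a b => (1 + tau ^+ 2 * a * b) /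
                             ((1 + tau * a) * (1 + tau * b)))
                 rho alpha^-1 mu beta^-1)
              (T_mu tau))%:E
           <= contraction_factor dot rho mu alpha beta (DRS tau))%E)].
Proof.
case: H_hilbert => dotxx _; exists (fun=> 0); split=> [//|].
move=> alpha beta rho alpha0 beta0 rho0 rho_le mu_le.
have ia0 : 0 <= alpha^-1 by rewrite invr_ge0 ltW.
have ib0 : 0 <= beta^-1 by rewrite invr_ge0 ltW.
pose proxE := prox_quadratic dot dotxx.
pose lower :=
  @contraction_factor_ge_scaling _ _ _ dotxx H_neq0 rho mu alpha beta.
have pos (tau a : R) : 0 < tau -> 0 <= a -> 0 < 1 + tau * a.
  by move=> tau0 a0; rewrite ltr_wpDr// mulr_ge0// ltW.
have reflectE (c : R) (x : H) : 2 *: (c *: x) - x = (2 * c - 1) *: x.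
  by rewrite scalerA scalerBl scale1r.
split=> tau tau0.
- move=> _.
  have GM_scaling (a b : R) (x : H) : GM dot tau (quadratic a) (quadratic b) x
      = (1 - tau * (a + b)) *: x.
    by rewrite /GM !grad_quadratic// -scalerDl scalerA scalerBl scale1r.
  rewrite EFin_max ge_max; apply/andP; split.
  + exact: (lower _ rho mu).
  + by rewrite [beta^-1 + _]addrC; apply: (lower _ alpha^-1 beta^-1).
- move=> _.
  have FBS1_scaling (a b : R) (x : H) : 0 <= b ->
      FBS1 dot tau (quadratic a) (quadratic b) x
      = ((1 + tau * b)^-1 * (1 - tau * a)) *: x.
    move=> b0; rewrite /FBS1 proxE ?pos//.
    by rewrite grad_quadratic// -scalerA scalerBl scale1r scalerA.
  have s0 := pos _ _ tau0 mu_ge0.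
  rewrite maxr_pMr; last by rewrite invr_ge0 ltW.
  rewrite EFin_max ge_max.
  rewrite -{1 2}(gtr0_norm s0) -!normfV -!normrM.
  by apply/andP; split; [apply: (lower _ rho mu) | apply: (lower _ alpha^-1 mu)]
    => // x; exact: FBS1_scaling.
- move=> _.
  have FBS2_scaling (a b : R) (x : H) : 0 <= a ->
      FBS2 dot tau (quadratic a) (quadratic b) x
      = ((1 + tau * a)^-1 * (1 - tau * b)) *: x.
    move=> a0; rewrite /FBS2 proxE ?pos//.
    by rewrite grad_quadratic// -scalerA scalerBl scale1r scalerA.
  have s0 := pos _ _ tau0 rho0.
  rewrite maxr_pMr; last by rewrite invr_ge0 ltW.
  rewrite EFin_max ge_max.
  rewrite -{1 2}(gtr0_norm s0) -!normfV -!normrM.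
  by apply/andP; split; [apply: (lower _ rho mu) | apply: (lower _ rho beta^-1)]
    => // x; exact: FBS2_scaling.
- have PRS_lower (a b : R) : 0 <= a -> rho <= a -> a <= alpha^-1 ->
      0 <= b -> mu <= b -> b <= beta^-1 ->
      ((`|1 - tau * a| / (1 + tau * a) * (`|1 - tau * b| / (1 + tau * b)))%:E
       <= contraction_factor dot rho mu alpha beta (PRS tau))%E.
    move=> a0 la ua b0 lb ub.
    have sa := pos _ _ tau0 a0; have sb := pos _ _ tau0 b0.
    rewrite -(gtr0_norm sa) -(gtr0_norm sb) -!normf_div -normrM.
    apply: (lower _ a b) => // x.
    rewrite /PRS !proxE// reflectE !scalerA -scalerBl.
    rewrite -[X in _ *: x + X]scale1r -scalerDl; congr (_ *: _).
    by field; rewrite !gt_eqF.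
  by rewrite /max_pairs !EFin_max !ge_max !PRS_lower.
- have DRS_lower (a b : R) : 0 <= a -> rho <= a -> a <= alpha^-1 ->
      0 <= b -> mu <= b -> b <= beta^-1 ->
      (((1 + tau ^+ 2 * a * b) / ((1 + tau * a) * (1 + tau * b)))%:E
       <= contraction_factor dot rho mu alpha beta (DRS tau))%E.
    move=> a0 la ua b0 lb ub.
    have sa := pos _ _ tau0 a0; have sb := pos _ _ tau0 b0.
    have k0 : 0 <= (1 + tau ^+ 2 * a * b) / ((1 + tau * a) * (1 + tau * b)).
      by rewrite divr_ge0// ?mulr_ge0// ?addr_ge0 ?mulr_ge0 ?sqr_ge0// ltW.
    rewrite -(ger0_norm k0); apply: (lower _ a b) => // x.
    rewrite /DRS !proxE// reflectE !scalerA -scalerBl.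
    rewrite -[X in _ *: x + X]scale1r -scalerDl; congr (_ *: _).
    by field; rewrite !gt_eqF.
  rewrite /max_pairs !EFin_max !ge_max !DRS_lower//=.
  by apply: contraction_factor_ge => r [].
Qed.
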